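(* For every positive integer $n$, the poset $\mathrm{AutCl}(D_n)$ is a distributive lattice, and for every positive integer $m$, the poset $\mathrm{AutCl}(Q_{4m})$ is a distributive lattice.
   Context: For a finite group $G$, let $L(G)$ be the set of subgroups of $G$. Define an equivalence relation on $L(G)$ by $H\equiv K$ iff there is $f\in\mathrm{Aut}(G)$ with $f(H)=K$; write $[H]$ for the class of $H$. $\mathrm{AutCl}(G)$ is the set $L(G)/\!\equiv$ of classes, partially ordered by: $[H]\lesssim[K]$ iff there are $H_1\in[H]$, $K_1\in[K]$ and $f\in\mathrm{Aut}(G)$ with $f(H_1)\subseteq K_1$. $D_n$ is the dihedral group of order $2n$, $D_n=\langle r,s\mid r^n=e,\ s^2=e,\ srs^{-1}=r^{-1}\rangle$ (so $D_1\cong\mathbb{Z}_2$, $D_2\cong\mathbb{Z}_2\times\mathbb{Z}_2$). $Q_{4m}$ is the (more) generalized quaternion, i.e. dicyclic, group of order $4m$, $Q_{4m}=\langle x,y\mid x^{2m}=e=y^4,\ yxy^{-1}=x^{-1},\ x^m=y^2\rangle$ (so $Q_4\cong\mathbb{Z}_4$ and $Q_8$ is the usual quaternion group). *)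

(* Defs.v *)
From HB Require Import structures.
From mathcomp Require Import all_boot all_order all_fingroup.

Set Implicit Arguments.
Unset Strict Implicit.
Unset Printing Implicit Defensive.

Import Order.TTheory.

(* The poset T is the underlying poset of some distributive lattice. *)
Definition is_distrLattice d (T : porderType d) : Prop :=
  exists L : distrLatticeType d, (L : porderType d) = T.

(* Unfolds is_distrLattice to binary infima and suprema. *)
Lemma is_distrLatticeP d (T : porderType d) :
  is_distrLattice T <->
  exists meet join : T -> T -> T,
    [/\ forall x y z : T, (x <= meet y z)%O = (x <= y)%O && (x <= z)%O,
        forall x y z : T, (join x y <= z)%O = (x <= z)%O && (y <= z)%O
      & left_distributive meet join].
Proof.
split=> [[L <-] | [meet [join [meetP joinP meetUl]]]].
  exists (@Order.meet d L), (@Order.join d L); split.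
  - exact: lexI.
  - exact: leUx.
  - exact: meetUl.
case: T meet join meetP joinP meetUl => T c meet join meetP joinP meetUl.
pose P : porderType d := Order.POrder.Pack c.
pose ML := @Order.POrder_MeetJoin_isLattice.Build d P meet join meetP joinP.
pose L : latticeType d := HB.pack T P ML.
pose MD := @Order.Lattice_Meet_isDistrLattice.Build d L meetUl.
pose D : distrLatticeType d := HB.pack T L MD.
by exists D.
Qed.

(* In mathcomp, Aut G is a set of permutations of the whole ambient type gT,
   namely those that fix every point outside G and restrict to automorphisms
   of G. *)
Definition autequiv (gT : finGroupType) (G : {group gT}) : rel {group gT} :=
  fun H K => [exists f in Aut G, f @: H == K].

Definition autclasses (gT : finGroupType) (G : {group gT}) :
    {set {set {group gT}}} :=
  equivalence_partition (autequiv G) (subgroups G).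

Record AutCl (gT : finGroupType) (G : {group gT}) := AutClass {
  autcl_set : {set {group gT}};
  _ : autcl_set \in autclasses G
}.

HB.instance Definition _ (gT : finGroupType) (G : {group gT}) :=
  [isSub of AutCl G for @autcl_set gT G].
HB.instance Definition _ (gT : finGroupType) (G : {group gT}) :=
  [Finite of AutCl G by <:].

Definition autcl_le (gT : finGroupType) (G : {group gT}) : rel (AutCl G) :=
  fun C D => [exists H in val C, exists K in val D,
                exists f in Aut G, f @: H \subset K].

Section AutClTheory.

Variables (gT : finGroupType) (G : {group gT}).
Implicit Types (H K L : {group gT}) (C D E : AutCl G).

Lemma imset_permM (f g : {perm gT}) (A : {set gT}) :
  (f * g)%g @: A = g @: (f @: A).
Proof. by rewrite -imset_comp; apply: eq_imset => x; rewrite permM. Qed.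

Lemma imset_perm1 (A : {set gT}) : (1%g : {perm gT}) @: A = A.
Proof. by rewrite -[RHS]imset_id; apply: eq_imset => x; rewrite perm1. Qed.

Lemma autequiv_refl : reflexive (autequiv G).
Proof.
by move=> H; apply/exists_inP; exists 1%g; rewrite ?group1 // imset_perm1.
Qed.

Lemma autequiv_sym : symmetric (autequiv G).
Proof.
suff sub H K : autequiv G H K -> autequiv G K H.
  by move=> H K; apply/idP/idP; apply: sub.
case/exists_inP=> f Af /eqP defK; apply/exists_inP; exists f^-1%g.
  by rewrite groupV.
by rewrite -defK -imset_permM mulgV imset_perm1.
Qed.

Lemma autequiv_trans : transitive (autequiv G).
Proof.
move=> K H L /exists_inP[f Af /eqP defK] /exists_inP[g Ag /eqP defL].
apply/exists_inP; exists (f * g)%g; first by rewrite groupM.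
by rewrite imset_permM defK defL.
Qed.

Lemma autclP C :
  exists2 H : {group gT}, H \in subgroups G &
    val C = [set K in subgroups G | autequiv G H K].
Proof. by case: C => C /= /imsetP[H sHG ->]; exists H. Qed.

Lemma autcl_equiv C H K : H \in val C -> K \in val C -> autequiv G H K.
Proof.
have [L _ ->] := autclP C; rewrite !inE => /andP[_ LH] /andP[_ LK].
by apply: autequiv_trans LK; rewrite autequiv_sym.
Qed.

Lemma eq_autcl C D H K :
  H \in val C -> K \in val D -> autequiv G H K -> C = D.
Proof.
move=> CH DK HK; apply: val_inj; apply/setP=> M.
have [L _ defC] := autclP C; have [L' _ defD] := autclP D.
move: CH DK; rewrite defC defD !inE => /andP[_ LH] /andP[_ L'K].
have LL' : autequiv G L L'.
  by apply: autequiv_trans LH (autequiv_trans HK _); rewrite autequiv_sym.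
congr (_ && _); apply/idP/idP; last exact: autequiv_trans.
by apply: autequiv_trans; rewrite autequiv_sym.
Qed.

Lemma autcl_le_refl : reflexive (@autcl_le _ G).
Proof.
move=> C; have [H sHG defC] := autclP C.
have CH : H \in val C by rewrite defC !inE in sHG *; rewrite sHG autequiv_refl.
apply/exists_inP; exists H => //; apply/exists_inP; exists H => //.
by apply/exists_inP; exists 1%g; rewrite ?group1 // imset_perm1.
Qed.

Lemma autcl_le_trans : transitive (@autcl_le _ G).
Proof.
move=> D C E /exists_inP[H CH /exists_inP[K DK /exists_inP[f Af sfK]]].
case/exists_inP=> K' DK' /exists_inP[L EL /exists_inP[g Ag sgL]].
have /exists_inP[h Ah /eqP defK'] := autcl_equiv DK DK'.
apply/exists_inP; exists H => //; apply/exists_inP; exists L => //.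
apply/exists_inP; exists (f * h * g)%g; first by rewrite !groupM.
by rewrite !imset_permM (subset_trans _ sgL) // imsetS // -defK' imsetS.
Qed.

Lemma autcl_le_anti : antisymmetric (@autcl_le _ G).
Proof.
move=> C D /andP[/exists_inP[H CH /exists_inP[K DK /exists_inP[f Af sfK]]]].
case/exists_inP=> K' DK' /exists_inP[H' CH' /exists_inP[g Ag sgH']].
have /exists_inP[h _ /eqP defK'] := autcl_equiv DK DK'.
have /exists_inP[k _ /eqP defH'] := autcl_equiv CH CH'.
have leKH : #|K| <= #|H|.
  have := subset_leq_card sgH'.
  by rewrite -defK' -defH' !(card_imset _ perm_inj).
apply: eq_autcl CH DK _; apply/exists_inP; exists f => //.
by rewrite eqEcard sfK (card_imset _ perm_inj).
Qed.

End AutClTheory.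

HB.instance Definition _ (gT : finGroupType) (G : {group gT}) :=
  Order.Le_isPOrder.Build (Order.Disp tt tt) (AutCl G)
    (@autcl_le_refl gT G) (@autcl_le_anti gT G) (@autcl_le_trans gT G).

(* G is isomorphic to the group D_n of order 2n. *)
Definition is_dihedral (gT : finGroupType) (n : nat) (G : {group gT}) : Prop :=
  (G \isog Grp (r : s : r ^+ n, s ^+ 2, s * r * s^-1 = r^-1))%g.

(* G is isomorphic to the dicyclic group Q_4m of order 4m. *)
Definition is_dicyclic (gT : finGroupType) (m : nat) (G : {group gT}) : Prop :=
  (G \isog Grp (x : y : x ^+ (2 * m)%N, y ^+ 4, y * x * y^-1 = x^-1,
                        x ^+ m = y ^+ 2))%g.

(* Main.v *)
(** Let G be D_n or Q_4m, X = <x> its cyclic subgroup of index 2 and y outside X.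
    Since y inverts X, so does every element outside X; hence for all g, h
    outside X the map fixing X pointwise and translating G \ X by h g^-1 is an
    automorphism sending g to h.  If X is characteristic, then [H] <= [K] iff
    |H /\ X| divides |K /\ X| and H is contained in X whenever K is, so the
    classes embed in a product of two distributive lattices.  The pairs (a, b)
    in the image are those with a | |X| and, if b holds, #[y^2] | a: they form
    a sublattice.  X is characteristic except in V_4 and Q_8, whose posets of
    classes are chains. *)
Require Import Defs.
From HB Require Import structures.
From mathcomp Require Import all_boot all_order all_fingroup.
From mathcomp Require Import all_algebra cyclic.

Set Implicit Arguments.
Unset Strict Implicit.
Unset Printing Implicit Defensive.

Import Order.TTheory GRing.Theory.
Local Open Scope group_scope.

(** * Criteria for a poset to be a distributive lattice *)

Lemma total_is_distrLattice d (T : porderType d) :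
  total (<=%O : rel T) -> is_distrLattice T.
Proof.
case: T => T c tot; pose P : porderType d := Order.POrder.Pack c.
pose TO := @Order.POrder_isTotal.Build d P tot.
pose L : orderType d := HB.pack T P TO.
by exists L.
Qed.

(** Meet and join are pulled back along [phi], which is injective because it reflects the order. The
    boolean [==] lets [xchoose] turn the existence hypotheses into operations. *)
Lemma embedding_is_distrLattice dT dL (T : porderType dT)
    (L : distrLatticeType dL) (phi : T -> L) :
    {mono phi : x y / (x <= y)%O} ->
    (forall x y, exists z, phi z == (phi x `&` phi y)%O) ->
    (forall x y, exists z, phi z == (phi x `|` phi y)%O) ->
  is_distrLattice T.
Proof.
move=> mono_phi exI exU; apply/is_distrLatticeP.
pose meet x y := xchoose (exI x y); pose join x y := xchoose (exU x y).
have phiI x y : phi (meet x y) = (phi x `&` phi y)%O.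
  exact/eqP/(xchooseP (exI x y)).
have phiU x y : phi (join x y) = (phi x `|` phi y)%O.
  exact/eqP/(xchooseP (exU x y)).
exists meet, join; split=> x y z.
- by rewrite -!mono_phi phiI lexI.
- by rewrite -!mono_phi phiU leUx.
- by apply: (inc_inj mono_phi); rewrite !(phiI, phiU) meetUl.
Qed.

(** * Representatives of automorphism classes *)

Section Representatives.

Variables (gT : finGroupType) (G : {group gT}).
Implicit Types (H K : {group gT}) (C D : AutCl G).

Lemma autcl_mem H : H \subset G -> exists C, H \in val C.
Proof.
move=> sHG; have clH : [set K in subgroups G | autequiv G H K] \in autclasses G.
  by apply/imsetP; exists H; rewrite ?inE.
by exists (AutClass clH); rewrite !inE sHG autequiv_refl.
Qed.

Lemma autcl_sub C H : H \in val C -> H \subset G.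
Proof. by have [K _ ->] := autclP C; rewrite !inE => /andP[]. Qed.

(** Composing with automorphisms between members of one class makes the order testable on any
    representatives. *)
Lemma autcl_leP C D H K : H \in val C -> K \in val D ->
  reflect (exists2 f, f \in Aut G & f @: H \subset K) (C <= D)%O.
Proof.
move=> CH DK; apply: (iffP idP) => [|[f Af sfHK]]; last first.
  apply/exists_inP; exists H => //; apply/exists_inP; exists K => //.
  by apply/exists_inP; exists f.
case/exists_inP=> H1 CH1 /exists_inP[K1 DK1 /exists_inP[f Af sfHK]].
have /exists_inP[g Ag /eqP defH1] := autcl_equiv CH CH1.
have /exists_inP[h Ah /eqP defK] := autcl_equiv DK1 DK.
exists (g * f * h); first by rewrite !groupM.
by rewrite !imset_permM defH1 -defK imsetS.
Qed.

Definition autcl_rep C : {group gT} := odflt 1%G [pick H in val C].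

Lemma autcl_repP C : autcl_rep C \in val C.
Proof.
rewrite /autcl_rep; case: pickP => //= C0; have [H sHG defC] := autclP C.
by have := C0 H; rewrite defC !inE in sHG *; rewrite sHG autequiv_refl.
Qed.

Lemma autcl_rep_sub C : autcl_rep C \subset G.
Proof. exact: autcl_sub (autcl_repP C). Qed.

Lemma autcl_rep_leP C D :
  reflect (exists2 f, f \in Aut G & f @: autcl_rep C \subset autcl_rep D)
          (C <= D)%O.
Proof. exact: autcl_leP (autcl_repP C) (autcl_repP D). Qed.

End Representatives.

(** Even powers of [y] lie in [A], odd ones in [A :* y]. *)
Lemma cycle_sqr_cosets (gT : finGroupType) (A : {group gT}) (y : gT) :
  y ^+ 2 \in A -> <[y]> \subset A :|: A :* y.
Proof.
move=> Ay2; apply/subsetP=> _ /cycleP[i ->].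
rewrite -(odd_double_half i) addnC expgD -mul2n expgM !inE.
have Ay2i : (y ^+ 2) ^+ i./2 \in A by rewrite groupX.
case: (odd i); last by rewrite mulg1 Ay2i.
by rewrite mem_rcoset expg1 mulgK Ay2i orbT.
Qed.

(** * Groups with a subgroup of index 2 inverted by an outside element *)

Section InvertedSubgroup.

Variables (gT : finGroupType) (G X : {group gT}) (y : gT).
Hypotheses (sXG : X \subset G) (indexX : #|G : X| = 2).
Hypotheses (Gy : y \in G) (X'y : y \notin X).
Hypothesis inv_y : {in X, forall x, x ^ y = x^-1}.
Implicit Types (H K : {group gT}).

(** Inversion agrees on [X] with conjugation by [y], so it is multiplicative there. *)
Lemma inverted_abelian : {in X &, commutative mulg}.
Proof.
move=> a b Xa Xb; apply: invg_inj; rewrite -inv_y ?groupM // conjMg !inv_y //.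
by rewrite invMg.
Qed.

Lemma index2_coset : G :\: X = X :* y.
Proof.
apply/esym/eqP; rewrite eqEcard card_rcoset; apply/andP; split.
  apply/subsetP=> _ /rcosetP[a Xa ->]; rewrite inE groupMl // X'y /=.
  by rewrite groupM ?(subsetP sXG a).
have := Lagrange sXG; rewrite indexX cardsD (setIidPr sXG) => <-.
by rewrite muln2 -addnn addKn.
Qed.

Lemma index2_mul g h : g \in G -> h \in G -> g \notin X -> h \notin X ->
  g * h^-1 \in X.
Proof.
move=> Gg Gh X'g X'h.
have [] : g \in X :* y /\ h \in X :* y by rewrite -index2_coset !inE X'g X'h.
case/rcosetP=> a Xa -> /rcosetP[b Xb ->].
by rewrite invMg mulgA mulgK groupMl // groupV.
Qed.

Lemma outside_inverts g x : g \in G -> g \notin X -> x \in X -> x ^ g = x^-1.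
Proof.
move=> Gg X'g Xx; have: g \in X :* y by rewrite -index2_coset inE X'g.
case/rcosetP=> a Xa ->; rewrite conjgM -inv_y //; congr (_ ^ y).
by rewrite conjgE (inverted_abelian Xx Xa) mulKg.
Qed.

(** For [g = a * y] with [a] in [X], moving [y] to the left inverts [a], which then cancels the
    second [a]. *)
Lemma outside_sqr g : g \in G -> g \notin X -> g ^+ 2 = y ^+ 2.
Proof.
move=> Gg X'g; have: g \in X :* y by rewrite -index2_coset inE X'g.
case/rcosetP=> a Xa ->; rewrite !expgS !expg0 !mulg1 {1}(conjgC a) inv_y //.
by rewrite -mulgA mulKg.
Qed.

Lemma sqr_outside_in : y ^+ 2 \in X.
Proof.
have := index2_mul Gy (groupVr Gy) X'y; rewrite groupV => /(_ X'y).
by rewrite invgK.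
Qed.

Definition translate (z g : gT) := if g \in X then g else z * g.

(** When [g] and [h] are both outside [X], [g] inverts [z], so the two factors [z] in
    [z * g * (z * h)] cancel. *)
Lemma translateM z : z \in X -> {in G &, {morph translate z : g h / g * h}}.
Proof.
move=> Xz g h Gg Gh; rewrite /translate.
have [Xg | X'g] := boolP (g \in X); have [Xh | X'h] := boolP (h \in X).
- by rewrite groupM.
- by rewrite groupMl // (negPf X'h) !mulgA (inverted_abelian Xz).
- by rewrite groupMr // (negPf X'g) mulgA.
have Xgh : g * h \in X by rewrite -[h]invgK index2_mul ?groupV.
rewrite Xgh mulgA -(mulgA z g z) (conjgCV g z).
by rewrite outside_inverts ?groupV // mulKVg.
Qed.

Lemma translate_Aut z : z \in X ->
  exists2 f, f \in Aut G & {in G, f =1 translate z}.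
Proof.
move=> Xz; pose f := Morphism (translateM Xz).
have injf : 'injm f.
  apply/subsetP=> g; rewrite !inE => /andP[Gg]; rewrite /= /translate.
  case: ifP => // X'g /eqP zg1.
  by rewrite -(groupMl g Xz) zg1 group1 in X'g.
have Gf : f @* G = G.
  apply/eqP; rewrite eqEcard card_injm // leqnn andbT.
  apply/subsetP=> _ /morphimP[g _ Gg ->]; rewrite /= /translate.
  by case: ifP => // _; rewrite groupM // (subsetP sXG).
by exists (aut injf Gf); [apply: Aut_aut | move=> g Gg; rewrite autE].
Qed.

(** Stated before [X] is assumed cyclic and characteristic: [AutCl_chain] applies it to an [X] that
    depends on the two subgroups. *)
Lemma sub_translate H K :
    H \subset G -> K \subset G -> H :&: X \subset K ->
    (H \subset X) || ~~ (K \subset X) ->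
  exists2 f, f \in Aut G & f @: H \subset K.
Proof.
move=> sHG sKG sHXK; have [sHX _ | not_sHX /= not_sKX] := boolP (H \subset X).
  exists 1; first exact: group1.
  by rewrite imset_perm1 -(setIidPl sHX).
have [h Hh X'h] := subsetPn not_sHX; have [k Kk X'k] := subsetPn not_sKX.
have [Gh Gk] := (subsetP sHG h Hh, subsetP sKG k Kk).
have [f Af Ef] := translate_Aut (index2_mul Gk Gh X'k X'h).
exists f => //; apply/subsetP=> _ /imsetP[g Hg ->].
have Gg := subsetP sHG g Hg; rewrite Ef // /translate.
case: ifPn => [Xg | X'g]; first by rewrite (subsetP sHXK) // inE Hg.
(* The image of [g] is [k * (h^-1 * g)], where [h^-1 * g] lies in [H :&: X], hence in [K]. *)
rewrite -mulgA groupMl // (subsetP sHXK) // inE groupM ?groupV //=.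
by rewrite -[g]invgK index2_mul ?groupV.
Qed.

Hypothesis cycX : cyclic X.
Hypothesis charX : X \char G.

Let char_imset f : f \in Aut G -> f @: X = X.
Proof.
move=> Af; apply/eqP; rewrite eqEcard (card_imset _ perm_inj) leqnn andbT.
by have /andP[_ /forall_inP->] := charX.
Qed.

(** [natdvd] is ordered by divisibility. The bit is negated because [false <= true]: subgroups of
    [X] must come below. *)
Definition invariant (C : AutCl G) : natdvd *p bool :=
  (#|autcl_rep C :&: X|, ~~ (autcl_rep C \subset X)).

(** In the cyclic group [X], divisibility of orders is inclusion of subgroups, so [sub_translate]
    applies; conversely every automorphism preserves [X]. *)
Lemma invariant_mono : {mono invariant : C D / (C <= D)%O}.
Proof.
move=> C D; have sCG := autcl_rep_sub C; have sDG := autcl_rep_sub D.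
rewrite leEprod /= dvdEnat leEbool.
apply/andP/autcl_rep_leP => [[sCDX sCX] | [f Af sfCD]].
  rewrite (cardSg_cyclic cycX) ?subsetIr // in sCDX.
  apply: sub_translate => //; first exact: subset_trans sCDX (subsetIl _ X).
  by move: sCX; do 2!case: (_ \subset X).
have fX := char_imset Af.
split.
  have sCXG : autcl_rep C :&: X \subset G.
    exact: subset_trans (subsetIr _ _) sXG.
  rewrite -(card_injm (injm_autm Af) sCXG) cardSg //= morphimEsub //.
  rewrite subsetI (subset_trans (imsetS _ (subsetIl _ _))) //=.
  by have := imsetS f (subsetIr (autcl_rep C) X); rewrite fX.
have [sDX | _] := boolP (autcl_rep D \subset X); last by case: (~~ _).
suff -> : autcl_rep C \subset X by [].
apply/subsetP=> g Cg; rewrite -(mem_imset _ _ (@perm_inj _ f)) fX.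
by rewrite (subsetP sDX) // (subsetP sfCD) ?imset_f.
Qed.

Lemma invariant_class H (C : AutCl G) : H \in val C ->
  invariant C = (#|H :&: X|, ~~ (H \subset X)).
Proof.
move=> CH; have /exists_inP[f Af /eqP defH] := autcl_equiv (autcl_repP C) CH.
have fX := char_imset Af.
rewrite -defH -fX -imsetI; last by move=> ? ? _ _ /perm_inj.
rewrite (card_imset _ perm_inj) /invariant; congr (_, ~~ _).
apply/idP/idP=> [|sfCX]; first exact: imsetS.
apply/subsetP=> g Cg; rewrite -(mem_imset _ _ (@perm_inj _ f)).
by rewrite (subsetP sfCX) ?imset_f.
Qed.

(** A subgroup with an element outside [X] contains the square of that element, which is [y ^+ 2].
    Conversely, if [A] is the subgroup of [X] of order [p.1], then [A] or [A <*> <[y]>] realizes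
    [p]. *)
Lemma invariantP (p : natdvd *p bool) :
  reflect (exists C, invariant C = p)
    ((p.1 %| #|X|)%N && (p.2 ==> (#[y ^+ 2] %| p.1)%N)).
Proof.
case: p => a b /=; apply: (iffP andP) => [[aX ya] | [C [<- <-]]]; last first.
  rewrite cardSg ?subsetIr //; split=> //; apply/implyP=> /subsetPn[g Cg X'g].
  have Gg := subsetP (autcl_rep_sub C) g Cg.
  rewrite -(outside_sqr Gg X'g) order_dvdG // inE groupX //=.
  by rewrite (outside_sqr Gg X'g) sqr_outside_in.
have [x defX] := cyclicP cycX.
have [A [sAX cardA]] : exists A : {group gT}, A \subset X /\ #|A| = a.
  exists <[x ^+ (#[x] %/ a)]>%G; rewrite defX in aX *.
  rewrite cycleX; split=> //.
  by rewrite -orderE orderXdiv ?dvdn_div // divnA // mulKn.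
case: b ya => [/= y2a | _]; last first.
  have [C CA] := autcl_mem (subset_trans sAX sXG).
  by exists C; rewrite (invariant_class CA) (setIidPl sAX) cardA sAX.
have Ay2 : y ^+ 2 \in A.
  rewrite -cycle_subG -(cardSg_cyclic cycX) ?cycle_subG ?sqr_outside_in //.
  by rewrite cardA.
have nAy : <[y]> \subset 'N(A).
  rewrite cycle_subG; apply/normP; apply/eqP.
  rewrite eqEcard cardJg leqnn andbT; apply/subsetP=> _ /imsetP[g Ag ->].
  by rewrite inv_y ?groupV // (subsetP sAX).
have [|C CH] := @autcl_mem _ G (A <*> <[y]>).
  by rewrite join_subG cycle_subG Gy (subset_trans sAX).
exists C; rewrite (invariant_class CH) join_subG cycle_subG (negPf X'y) andbF.
(* By the modular law the intersection with [X] is [A * (<[y]> :&: X)]. The second factor lies in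
   [A], since [<[y]>] is covered by [A] and [A :* y], and the latter misses [X]. *)
rewrite /= norm_joinEr // -group_modl // mulGSid ?cardA //.
apply/subsetP=> g /setIP[/(subsetP (cycle_sqr_cosets Ay2))/setUP[] //].
by case/rcosetP=> h Ah ->; rewrite groupMl ?(negPf X'y) // (subsetP sAX).
Qed.

Lemma AutCl_inverted_is_distrLattice : is_distrLattice (AutCl G).
Proof.
have inv (C : AutCl G) : (#|autcl_rep C :&: X| %| #|X|)%N &&
    (~~ (autcl_rep C \subset X) ==> (#[y ^+ 2] %| #|autcl_rep C :&: X|)%N).
  by have /invariantP: exists D, invariant D = invariant C by exists C.
apply: (embedding_is_distrLattice invariant_mono) => C D.
  suff: exists E, invariant E = (invariant C `&` invariant D)%O.
    by case=> E /eqP; exists E.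
  apply/invariantP; rewrite /= gcdEnat.
  have /andP[cX cy] := inv C; have /andP[dX dy] := inv D.
  rewrite (dvdn_trans (dvdn_gcdl _ _)) //=; apply/implyP=> /andP[c d].
  by rewrite dvdn_gcd (implyP cy) // (implyP dy).
suff: exists E, invariant E = (invariant C `|` invariant D)%O.
    by case=> E /eqP; exists E.
apply/invariantP; rewrite /= lcmEnat.
have /andP[cX cy] := inv C; have /andP[dX dy] := inv D.
(* A single true bit suffices: [#[y ^+ 2]] then divides that order, hence the lcm. *)
rewrite dvdn_lcm cX dX /=; apply/implyP=> /orP[c | d].
  by rewrite (dvdn_trans (implyP cy c)) // dvdn_lcml.
by rewrite (dvdn_trans (implyP dy d)) // dvdn_lcmr.
Qed.

End InvertedSubgroup.

(* The groups in question are V_4 (with w = 1) and Q_8 (with w = -1): two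
   incomparable subgroups meet in <[w]>, and translation along the third subgroup
   containing <[w]> with index 2 maps one onto the other. *)
Lemma AutCl_chain (gT : finGroupType) (G : {group gT}) (w : gT) :
    w \in G -> w ^+ 2 = 1 -> #|G : <[w]>| = 4 ->
    {in G, forall g, g \notin <[w]> -> g ^+ 2 = w} ->
  total (<=%O : rel (AutCl G)).
Proof.
move=> Gw w2 indexw sqrG C D; pose H := autcl_rep C; pose K := autcl_rep D.
have sHG : H \subset G := autcl_rep_sub C.
have sKG : K \subset G := autcl_rep_sub D.
have in_w g : g \in <[w]> -> g = 1 \/ g = w.
  case/cycleP=> i ->; rewrite -(odd_double_half i) expgD -mul2n expgM w2.
  by rewrite expg1n mulg1; case: (odd i); [right | left].
(* As [g] is not 1, either [g = w] or [g ^+ 2 = w]. *)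
have w_in (A B : {group gT}) g :
    A \subset G -> g \in A -> g \notin B -> w \in A.
  move=> sAG Ag B'g; have Gg := subsetP sAG g Ag.
  have [/in_w[g1 | <- //] | w'g] := boolP (g \in <[w]>).
    by rewrite g1 group1 in B'g.
  by rewrite -(sqrG g) // groupX.
have [sHK | /subsetPn[h Hh K'h]] := boolP (H \subset K).
  apply/orP; left; apply/autcl_rep_leP; exists 1; first exact: group1.
  by rewrite imset_perm1.
have [sKH | /subsetPn[k Kk H'k]] := boolP (K \subset H).
  apply/orP; right; apply/autcl_rep_leP; exists 1; first exact: group1.
  by rewrite imset_perm1.
apply/orP; left; apply/autcl_rep_leP; rewrite -/H -/K.
have [Hw Kw] := (w_in H K h sHG Hh K'h, w_in K H k sKG Kk H'k).
have [Gh Gk] := (subsetP sHG h Hh, subsetP sKG k Kk).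
have w'h : h \notin <[w]>.
  by apply: contra K'h; apply: subsetP; rewrite cycle_subG.
have w'k : k \notin <[w]>.
  by apply: contra H'k; apply: subsetP; rewrite cycle_subG.
have H'hk : h * k \notin H by rewrite groupMl.
have K'hk : h * k \notin K by rewrite groupMr.
have w'hk : h * k \notin <[w]>.
  by apply: contra H'hk; apply: subsetP; rewrite cycle_subG.
have Ghk : h * k \in G by rewrite groupM.
have hk2 := sqrG _ Ghk w'hk.
(* Since [h * k] is in neither [H] nor [K], this [X] meets both exactly in [<[w]>]. *)
pose X := <[h * k]>%G.
have Xw : <[w]> \subset X by rewrite cycle_subG -hk2 mem_cycle.
have sX : X \subset <[w]> :|: <[w]> :* (h * k).
  by apply: cycle_sqr_cosets; rewrite hk2 cycle_id.
have XI (A : {group gT}) : w \in A -> h * k \notin A -> A :&: X = <[w]>.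
  move=> Aw A'hk; apply/eqP; rewrite eqEsubset subsetI Xw cycle_subG Aw !andbT.
  apply/subsetP=> g /setIP[Ag /(subsetP sX)/setUP[] // /rcosetP[z wz defg]].
  have Az: z \in A by apply: subsetP wz; rewrite cycle_subG.
  by rewrite -(groupMl _ Az) -defg Ag in A'hk.
have sXG : X \subset G by rewrite cycle_subG.
have X'h : h \notin X.
  by apply: contra w'h => Xh; rewrite -(XI H) // inE Hh.
have X'k : k \notin X.
  by apply: contra w'k => Xk; rewrite -(XI K) // inE Kk.
apply: (@sub_translate _ G X h) => //.
- have indexXw : #|X : <[w]>| = 2.
    apply/eqP; rewrite eqn_leq indexg_gt1 andbC.
    rewrite (contra _ w'hk) => [|/subsetP->]; rewrite ?cycle_id //=.
    rewrite -(leq_pmul2l (order_gt0 w)) -/(#|<[w]>|) (Lagrange Xw).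
    rewrite (leq_trans (subset_leq_card sX)) //.
    rewrite (leq_trans (leq_card_setU _ _)) //.
    by rewrite card_rcoset addnn -muln2.
  have := Lagrange_index sXG Xw; rewrite indexXw indexw -[4]/(2 * 2)%N.
  by move/eqP; rewrite eqn_pmul2r // => /eqP.
(* [(h * k) ^ h = k * h] is the inverse of [h * k], because [k ^+ 2 * h ^+ 2 = w ^+ 2 = 1]. *)
- move=> _ /cycleP[i ->]; rewrite conjXg -expgVn; congr (_ ^+ i).
  rewrite conjgE -mulgA mulKg invMg; apply: (mulgI k); rewrite mulKVg mulgA.
  apply: (mulIg h); rewrite mulVg.
  transitivity (k ^+ 2 * h ^+ 2); first by rewrite !expgS !expg0 !mulg1 !mulgA.
  by rewrite !sqrG.
- by rewrite [H :&: X]XI // cycle_subG.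
- by apply/orP; right; apply: contra X'k => /subsetP->.
Qed.

(** The relations give only upper bounds: [#[x] <= n], and [G] is covered by two cosets of [<[x]>].
    The lower bound on [#|G|] forces equality throughout. *)
Lemma inverted_generators (gT : finGroupType) (G : {group gT}) (n : nat)
    (x y : gT) :
    0 < n -> <[x]> <*> <[y]> = G -> x ^+ n = 1 -> y * x * y^-1 = x^-1 ->
    y ^+ 2 \in <[x]> -> 2 * n <= #|G| ->
  [/\ #[x] = n, #|G : <[x]>| = 2, y \notin <[x]>
    & {in <[x]>, forall z, z ^ y = z^-1}].
Proof.
move=> n_gt0 defG xn1 yxV y2 leG.
have xy : x ^ y = x^-1.
  apply: invg_inj; rewrite -conjVg invgK -yxV conjgE !mulgA.
  by rewrite mulVg mul1g mulgKV.
have sXG : <[x]> \subset G by rewrite -defG joing_subl.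
have inv_y : {in <[x]>, forall z, z ^ y = z^-1}.
  by move=> _ /cycleP[i ->]; rewrite conjXg xy expgVn.
have nXy : <[y]> \subset 'N(<[x]>).
  by rewrite cycle_subG; apply/normP; rewrite -cycleJ xy cycleV.
have sGX : G \subset <[x]> :|: <[x]> :* y.
  rewrite -defG norm_joinEr //; apply/subsetP=> _ /mulsgP[a b Xa yb ->].
  have := subsetP (cycle_sqr_cosets y2) b yb; rewrite !inE !mem_rcoset.
  by rewrite -mulgA !(groupMl _ Xa).
have leX : #[x] <= n by rewrite dvdn_leq // order_dvdn xn1.
have leG2 : #|G| <= 2 * #[x].
  rewrite (leq_trans (subset_leq_card sGX)) //.
  rewrite (leq_trans (leq_card_setU _ _)) //.
  by rewrite card_rcoset addnn -mul2n.
have ox : #[x] = n.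
  by apply/eqP; rewrite eqn_leq leX -(leq_pmul2l (isT : 0 < 2)) (leq_trans leG).
have cardG : #|G| = (2 * n)%N by apply/eqP; rewrite eqn_leq leG -ox leG2.
split=> //.
  by apply/eqP; rewrite -(eqn_pmul2l (order_gt0 x)) Lagrange // cardG -ox mulnC.
apply: contraL leG => Xy; rewrite -ltnNge.
have sG : G \subset <[x]> by rewrite -defG join_subG subxx cycle_subG.
by rewrite (leq_ltn_trans (subset_leq_card sG)) // -orderE ox ltn_Pmull.
Qed.

(** * Permutation models bounding the group orders from below *)

Section Model.

Variables (n : nat) (m : 'I_n.+1).
(** In Z/(n+1) the solutions are 0, for the dihedral group, and (n+1)/2 when n+1 is even, for the
    dicyclic group. *)
Hypothesis mm0 : (m + m = 0)%R.

(* (i, b) stands for the element x^i y^b, on which the model generators act by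
   left multiplication: by x, giving (i + 1, b), and by y, giving (-i, 1) or
   (m - i, 0). *)
Let T := ('I_n.+1 * bool)%type.
Let c : 'I_n.+1 := inZp 1.

Definition model_rot (t : T) : T := (t.1 + c, t.2)%R.
Definition model_flip (t : T) : T := ((if t.2 then m else 0) - t.1, ~~ t.2)%R.

Lemma model_rot_inj : injective model_rot.
Proof.
move=> [i b] [j d] eq_ij; congr (_, _); last by have := congr1 snd eq_ij.
exact/(addIr c)/(congr1 fst eq_ij).
Qed.

Lemma model_flip_inj : injective model_flip.
Proof.
move=> [i b] [j d] eq_ij; have bd : b = d := negb_inj (congr1 snd eq_ij).
rewrite bd in eq_ij *; congr (_, _).
exact/oppr_inj/(addrI (if d then m else 0%R))/(congr1 fst eq_ij).
Qed.

Let x := perm model_rot_inj.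
Let y := perm model_flip_inj.

Lemma model_rotX k t : (x ^+ k) t = (t.1 + inZp k, t.2)%R.
Proof.
elim: k => [|k IHk].
  rewrite expg0 perm1; case: t => i b /=; congr (_, _); apply: val_inj => /=.
  by rewrite mod0n addn0 modn_small.
rewrite expgSr permM IHk permE /model_rot /=; congr (_, _); apply: val_inj => /=.
by rewrite !(modnDml, modnDmr) addnAC modnDmr -addnA add1n.
Qed.

Lemma model_rot_order : x ^+ n.+1 = 1.
Proof.
apply/permP=> -[i b]; rewrite model_rotX perm1 /=; congr (_, _).
by apply: val_inj => /=; rewrite modnn addn0 modn_small.
Qed.

Lemma model_flip_conj : y * x * y^-1 = x^-1.
Proof.
apply: (mulIg y); rewrite mulgKV; apply: (mulgI x); rewrite mulKVg.
apply/permP=> -[i b]; rewrite !permM !permE /= /model_rot /model_flip /=.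
by congr (_, _); rewrite opprD addrA subrK.
Qed.

Lemma model_flip_sqr : y ^+ 2 = x ^+ m.
Proof.
apply/permP=> -[i b]; rewrite model_rotX expgS expg1 permM !permE /model_flip /=.
rewrite negbK valZpK opprB addrCA; congr (_ + _, _)%R.
(* From [b = true] two flips translate by [-m], which is [m] by [mm0]. *)
by case: b; rewrite /= ?subr0 // sub0r; apply: (addrI m); rewrite subrr.
Qed.

(** The orbit of [(0, false)] is all of [T], and a group is at least as large as any of its
    orbits. *)
Lemma model_card : 2 * n.+1 <= #|<[x]> <*> <[y]>|.
Proof.
have <- : #|{: T}| = (2 * n.+1)%N by rewrite card_prod card_ord card_bool mulnC.
pose eval (p : {perm T}) := p (0%R, false).
suff sT : [set: T] \subset eval @: (<[x]> <*> <[y]>).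
  by rewrite -cardsT (leq_trans (subset_leq_card sT)) ?leq_imset_card.
apply/subsetP=> -[i b] _.
pose p := y ^+ b * x ^+ i.
have -> : (i, b) = eval p.
  rewrite /eval permM model_rotX; case: b {p}; rewrite ?expg1 ?expg0 ?perm1 ?permE.
    by rewrite /model_flip /= subr0 add0r valZpK.
  by rewrite /= add0r valZpK.
apply: imset_f; rewrite groupM // groupX // mem_gen // inE cycle_id ?orbT //.
Qed.

End Model.


(** * Generators and order bounds from the presentations *)

Lemma dihedral_generators n (gT : finGroupType) (G : {group gT}) :
    0 < n -> is_dihedral n G ->
  exists x y : gT, [/\ <[x]> <*> <[y]> = G, x ^+ n = 1, y ^+ 2 = 1,
    y * x * y^-1 = x^-1 & 2 * n <= #|G|].
Proof.
move=> n_gt0 isoG; have /existsP[[x y] /=] := isoGrp_hom isoG.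
rewrite !xpair_eqE => /and4P[/eqP defG /eqP xn /eqP y2 /eqP yxV].
exists x, y; split=> //; case: n n_gt0 isoG {xn} => // n _ isoG.
have mm0 : (0 + 0 = 0 :> 'I_n.+1)%R by rewrite addr0.
(* The model satisfies the relations with [m = 0], so it is a homomorphic image of [G]. *)
apply: leq_trans (model_card 0%R) (leq_homg _).
rewrite isoG; apply/existsP; exists (perm (@model_rot_inj n), perm (@model_flip_inj n 0%R)).
by rewrite /= !xpair_eqE model_rot_order model_flip_sqr // model_flip_conj !eqxx.
Qed.

Lemma dicyclic_generators m (gT : finGroupType) (G : {group gT}) :
    0 < m -> is_dicyclic m G ->
  exists x y : gT, [/\ <[x]> <*> <[y]> = G, x ^+ (2 * m) = 1, y ^+ 2 = x ^+ m,
    y * x * y^-1 = x^-1 & 2 * (2 * m) <= #|G|].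
Proof.
move=> m_gt0 isoG; have /existsP[[x y] /=] := isoGrp_hom isoG.
rewrite !xpair_eqE.
case/and5P=> /eqP defG /eqP xn /eqP y4 /eqP yxV /eqP xm.
exists x, y; split=> //.
have [n defn] : exists n, (2 * m = n.+1)%N.
  by exists (2 * m).-1; rewrite prednK ?muln_gt0.
have mn : m < n.+1 by rewrite -defn ltn_Pmull.
(* The model over Z/(2m), where the class of [m] is its own opposite. *)
have mm0 : (Ordinal mn + Ordinal mn = 0)%R.
  by apply: val_inj; rewrite /= addnn -mul2n defn modnn.
rewrite defn; apply: leq_trans (model_card (Ordinal mn)) (leq_homg _).
rewrite isoG; apply/existsP; exists (perm (@model_rot_inj n),
  perm (@model_flip_inj n (Ordinal mn))).
rewrite /= !xpair_eqE defn model_rot_order -[4]/(2 * 2)%N expgM.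
rewrite (model_flip_sqr mm0) // model_flip_conj -expgM mulnC /= defn.
by rewrite model_rot_order !eqxx.
Qed.

(* An automorphism moving x out of <[x]> would send x ^+ 2 to y ^+ 2. *)
Lemma cycle_char_inverted (gT : finGroupType) (G : {group gT}) (x y : gT) :
    x \in G -> y \in G -> #|G : <[x]>| = 2 -> y \notin <[x]> ->
    {in <[x]>, forall z, z ^ y = z^-1} -> #[x ^+ 2] != #[y ^+ 2] ->
  <[x]> \char G.
Proof.
move=> Gx Gy indexX X'y inv_y neq_x2y2.
have sXG : <[x]> \subset G by rewrite cycle_subG.
rewrite /characteristic sXG; apply/forall_inP=> f Af.
have := morphim_cycle (autm_morphism Af) Gx; rewrite morphimEsub //= => ->.
rewrite cycle_subG; apply: contraR neq_x2y2 => X'fx.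
have Gfx : f x \in G by rewrite Aut_closed.
rewrite -(outside_sqr sXG indexX Gy X'y inv_y Gfx X'fx) -(autmE Af) -morphX //.
by rewrite order_injm ?injm_autm ?groupX.
Qed.

(** [AutCl_chain] applies with [w = x ^+ 2]: an element outside [<[w]>] is an odd power of [x], or
    lies outside [<[x]>] and has square [y ^+ 2]; both squares are [w]. *)
Lemma AutCl_sqr_eq_is_distrLattice (gT : finGroupType) (G : {group gT})
    (x y : gT) :
    <[x]> <*> <[y]> = G -> x ^+ 2 = y ^+ 2 -> (x ^+ 2) ^+ 2 = 1 ->
    #[x] = (2 * #[x ^+ 2])%N -> #|G : <[x]>| = 2 -> y \notin <[x]> ->
    {in <[x]>, forall z, z ^ y = z^-1} ->
  is_distrLattice (AutCl G).
Proof.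
move=> defG xy2 x4 ox indexX X'y inv_y; apply: total_is_distrLattice.
have sXG : <[x]> \subset G by rewrite -defG joing_subl.
have Gy : y \in G by rewrite -cycle_subG -defG joing_subr.
have sx2 : <[x ^+ 2]> \subset <[x]> by rewrite cycle_subG mem_cycle.
apply: (@AutCl_chain _ _ (x ^+ 2)).
- by rewrite groupX // -cycle_subG.
- exact: x4.
- rewrite -(Lagrange_index sXG sx2) indexX.
  by rewrite -divgS // -!orderE ox mulnK.
move=> g Gg x2'g; have [/cycleP[i defg] | X'g] := boolP (g \in <[x]>); last first.
  by rewrite (outside_sqr sXG indexX Gy X'y inv_y).
have odd_i : odd i.
  apply: contraR x2'g => even_i; rewrite defg -(odd_double_half i) (negPf even_i).
  by rewrite add0n -mul2n expgM mem_cycle.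
rewrite defg -expgM mulnC expgM -(odd_double_half i) odd_i expgD -mul2n.
by rewrite (expgM _ 2) x4 expg1n mulg1.
Qed.

Theorem mainTheorem2 :
  (forall (n : nat) (gT : finGroupType) (G : {group gT}),
     0 < n -> is_dihedral n G -> is_distrLattice (AutCl G)) /\
  (forall (m : nat) (gT : finGroupType) (G : {group gT}),
     0 < m -> is_dicyclic m G -> is_distrLattice (AutCl G)).
Proof.
split=> [n | m] gT G.
  move=> n_gt0 /(dihedral_generators n_gt0)[x [y [defG xn y2 yxV leG]]].
  have y2X : y ^+ 2 \in <[x]> by rewrite y2.
  have [ox indexX X'y inv_y] := inverted_generators n_gt0 defG xn yxV y2X leG.
  have sXG : <[x]> \subset G by rewrite -defG joing_subl.
  have Gx : x \in G by rewrite -cycle_subG.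
  have Gy : y \in G by rewrite -cycle_subG -defG joing_subr.
  (* For [n = 2] the group is V_4, where [<[x]>] is not characteristic. *)
  have [n2 | n_neq2] := eqVneq n 2.
    have x2 : x ^+ 2 = 1 by rewrite -n2.
    apply: (AutCl_sqr_eq_is_distrLattice defG) => //; first by rewrite x2.
      by rewrite x2 expg1n.
    by rewrite x2 order1 ox n2.
  apply: (AutCl_inverted_is_distrLattice sXG indexX Gy X'y inv_y).
    exact: cycle_cyclic.
  (* For [n = 1] the squares of [x] and [y] also agree, but [<[x]>] is trivial. *)
  have [n1 | n_neq1] := eqVneq n 1%N.
    by move: xn; rewrite n1 expg1 => ->; rewrite /= cycle1 char1.
  apply: (cycle_char_inverted Gx Gy indexX X'y inv_y).
  rewrite y2 order1 order_eq1 -order_dvdn ox dvdn_divisors //.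
  by rewrite !inE negb_or n_neq1.
move=> m_gt0 /(dicyclic_generators m_gt0)[x [y [defG xn y2 yxV leG]]].
have n_gt0 : 0 < 2 * m by rewrite muln_gt0.
have y2X : y ^+ 2 \in <[x]> by rewrite y2 mem_cycle.
have [ox indexX X'y inv_y] := inverted_generators n_gt0 defG xn yxV y2X leG.
have sXG : <[x]> \subset G by rewrite -defG joing_subl.
have Gx : x \in G by rewrite -cycle_subG.
have Gy : y \in G by rewrite -cycle_subG -defG joing_subr.
have ox2 : #[x ^+ 2] = m by rewrite orderXdiv ox ?mulKn ?dvdn_mulr.
have oy2 : #[y ^+ 2] = 2 by rewrite y2 orderXdiv ox ?mulnK ?dvdn_mull.
(* [x ^+ 2] and [y ^+ 2] have orders [m] and 2, equal only for Q_8. *)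
have [m2 | m_neq2] := eqVneq m 2.
  apply: (AutCl_sqr_eq_is_distrLattice defG) => //; first by rewrite y2 m2.
    by rewrite -[RHS]xn m2 -expgM.
  by rewrite ox2.
apply: (AutCl_inverted_is_distrLattice sXG indexX Gy X'y inv_y).
  exact: cycle_cyclic.
by apply: (cycle_char_inverted Gx Gy indexX X'y inv_y); rewrite ox2 oy2.
Qed.
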